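(* Let $\alpha_1,\alpha_2,\alpha_3>0$, $\lambda_1,\lambda_2,\lambda_3\ge0$, $\alpha^+=\alpha_1+\alpha_2+\alpha_3$, $\lambda^+=\lambda_1+\lambda_2+\lambda_3$, and let $(X''_1,X''_2)\sim\mathrm{CNcDir}^2(\alpha_1,\alpha_2,\alpha_3,\lambda_1,\lambda_2,\lambda_3)$. Then for all positive integers $r_1,r_2$, with $r^+=r_1+r_2$, $$\mathbb E\left[(X''_1)^{r_1}(X''_2)^{r_2}\right]=\frac{(\alpha_1)_{r_1}(\alpha_2)_{r_2}}{(\alpha^+)_{r^+}}\sum_{j_1=0}^{r_1}\sum_{j_2=0}^{r_2}\frac{\binom{r_1}{j_1}\binom{r_2}{j_2}\left(\frac{\lambda_1}{4}\right)^{j_1}\left(\frac{\lambda_2}{4}\right)^{j_2}}{(\alpha_1)_{j_1}(\alpha_2)_{j_2}(\alpha^++r^+)_{j^+}}\cdot\frac{{}_0F_1\left(\alpha^++r^++j^+;\frac{\lambda^+}{4}\right)}{{}_0F_1\left(\alpha^+;\frac{\lambda^+}{4}\right)},$$ where $j^+=j_1+j_2$.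
   Context: Notation: $\mathcal S^2=\{(x_1,x_2):0<x_1<1,\ 0<x_2<1,\ x_1+x_2<1\}$; $(a)_l=\Gamma(a+l)/\Gamma(a)$; ${}_0F_1(b;x)=\sum_{i\ge0}\frac{1}{(b)_i}\frac{x^i}{i!}$; $0^0=1$. The bivariate Conditional Non-central Dirichlet distribution $\mathrm{CNcDir}^2(\alpha_1,\alpha_2,\alpha_3,\lambda_1,\lambda_2,\lambda_3)$ is the distribution on $\mathcal S^2$ with density, writing $x_3=1-x_1-x_2$, $$f(x_1,x_2)=\frac{\Gamma(\alpha^+)}{\Gamma(\alpha_1)\Gamma(\alpha_2)\Gamma(\alpha_3)}\,x_1^{\alpha_1-1}x_2^{\alpha_2-1}x_3^{\alpha_3-1}\cdot\frac{\prod_{i=1}^3{}_0F_1\left(\alpha_i;\frac{\lambda_i}{4}x_i\right)}{{}_0F_1\left(\alpha^+;\frac{\lambda^+}{4}\right)} .$$ (Equivalently, it is the conditional law of $(Y'_1/Y'^+,Y'_2/Y'^+)$ given $Y'^+=Y'_1+Y'_2+Y'_3=1$, with independent Non-central Chi-Squared $Y'_i$ having $2\alpha_i$ degrees of freedom and non-centrality $\lambda_i$.) *)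

(* Defs.v *)
From HB Require Import structures.
From mathcomp Require Import all_boot all_order all_algebra.
From mathcomp Require Import all_classical all_reals all_analysis.

Set Implicit Arguments.
Unset Strict Implicit.
Unset Printing Implicit Defensive.

Import Order.TTheory GRing.Theory Num.Theory.
Import numFieldNormedType.Exports.

Local Open Scope classical_set_scope.
Local Open Scope ring_scope.

(* Euler's integral; [Gamma a] is only meaningful for [0 < a]. *)
Definition Gamma (R : realType) (a : R) : R :=
  \int[lebesgue_measure]_(t in `]0, +oo[) (t `^ (a - 1) * expR (- t)).

Definition pochhammer (R : realType) (a : R) (l : nat) : R :=
  Gamma (a + l%:R) / Gamma a.

Definition hyp0F1 (R : realType) (b x : R) : R :=
  limn (series (fun i : nat => (pochhammer b i)^-1 * (x ^+ i / i`!%:R))).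

Definition simplex2 (R : realType) : set (R * R) :=
  [set x | [/\ 0 < x.1 < 1, 0 < x.2 < 1 & x.1 + x.2 < 1]].
Arguments simplex2 R : clear implicits.

(* The values outside [simplex2 R] are irrelevant: the law below integrates
   this function over subsets of the simplex only. *)
Definition CNcDir2_pdf (R : realType) (a1 a2 a3 l1 l2 l3 : R) (x : R * R) : R :=
  let x3 := 1 - x.1 - x.2 in
  Gamma (a1 + a2 + a3) / (Gamma a1 * Gamma a2 * Gamma a3) *
  (x.1 `^ (a1 - 1) * x.2 `^ (a2 - 1) * x3 `^ (a3 - 1)) *
  ((hyp0F1 a1 (l1 / 4 * x.1) * hyp0F1 a2 (l2 / 4 * x.2) *
    hyp0F1 a3 (l3 / 4 * x3)) /
   hyp0F1 (a1 + a2 + a3) ((l1 + l2 + l3) / 4)).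

Definition CNcDir2 (R : realType) (a1 a2 a3 l1 l2 l3 : R) (A : set (R * R))
    : \bar R :=
  (\int[(lebesgue_measure \x lebesgue_measure)]_(x in A `&` simplex2 R)
     (CNcDir2_pdf a1 a2 a3 l1 l2 l3 x)%:E)%E.

Definition has_CNcDir2_law (d : measure_display) (T : measurableType d)
    (R : realType) (P : probability T R) (X1 X2 : {RV P >-> R})
    (a1 a2 a3 l1 l2 l3 : R) : Prop :=
  forall A : set (R * R), measurable A ->
    pushforward P (fun w => (X1 w, X2 w)) A = CNcDir2 a1 a2 a3 l1 l2 l3 A.

(* Main.v *)
Require Import Defs.
From HB Require Import structures.
From mathcomp Require Import all_boot all_order all_algebra.
From mathcomp Require Import all_classical all_reals all_analysis.
From mathcomp Require Import measurable_realfun zify.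
From mathcomp Require Import ring lra.

Import Order.TTheory GRing.Theory Num.Theory.
Import numFieldNormedType.Exports.

Local Open Scope classical_set_scope.
Local Open Scope ring_scope.

(* Expanding the three 0F1 factors turns the moment into a triple series of
   Dirichlet integrals with nonnegative terms, so that sums and integrals can be
   exchanged freely. Up to a constant, with [x1 = l1 / 4], [x2 = l2 / 4] and
   [x3 = l3 / 4], the general term is
     (a1 + i)_r1 (a2 + j)_r2 / (a)_(i + j + k + r) * x1^i x2^j x3^k / (i! j! k!).
   The Chu-Vandermonde identity
     (a1 + i)_r1 = sum_s C(r1, s) (a1 + s)_(r1 - s) i (i - 1) ... (i - s + 1)
   lets the falling factorials absorb a shift of the summation indices, and the
   multinomial theorem then resums the triple series into a single 0F1.
   The Dirichlet integral comes from the convolution identity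
     t_+^(a-1) * t_+^(b-1) = B(a, b) t_+^(a+b-1),
   which also gives [Gamma a * Gamma b = B(a, b) * Gamma (a + b)]. *)

(** * Affine change of variables and truncated powers *)

Section pospow.
Context {R : realType}.
Notation mu := (@lebesgue_measure R).
Implicit Types (a c k t : R) (f : R -> \bar R).

(** The image of Lebesgue measure under [x |-> k * x + c], scaled by [k], gives every half-open
    interval its length, so it is Lebesgue measure by uniqueness. *)
Lemma ge0_integral_affine k c f : 0 < k -> measurable_fun setT f ->
  (forall x, 0 <= f x)%E ->
  (k%:E * \int[mu]_x f (k * x + c)%R = \int[mu]_x f x)%E.
Proof.
move=> k0 mf f0.
pose phi := fun x : measurableTypeR R => k * x + c : measurableTypeR R.
have mphi : measurable_fun setT phi.
  by apply: measurable_funD => //; apply: measurable_funM.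
have kge0 : 0 <= k by exact: ltW.
pose nu := mscale (NngNum kge0)
  (measure_function_pushforward__canonical__measure_function_Measure mu mphi).
rewrite [RHS](@eq_measure_integral _ _ _ _ nu)/=.
  rewrite ge0_integral_mscale//=.
  rewrite (ge0_integral_pushforward mphi)//=.
move=> A mA _.
apply: lebesgue_measure_unique => //= _ [[a b] _ <-] /=.
rewrite /mscale/= /pushforward.
have -> : phi @^-1` `]a, b]%classic = `](a - c) / k, (b - c) / k]%classic.
  by apply/seteqP; split => x /=; rewrite !in_itv/= /phi ltr_pdivrMr//
    ler_pdivlMr// ltrBlDr lerBrDr [x * k]mulrC.
rewrite !lebesgue_measure_itv/= !lte_fin ltr_pM2r ?invr_gt0// ltrD2r.
case: ifPn => _; last by rewrite mule0.
by rewrite -!EFinB -EFinM; congr EFin; field; rewrite gt_eqF.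
Qed.

(* [t^(a-1)] on the positive half-line, extended by [0]: with it every integral
   below is over the whole space. *)
Definition pospow a t : R := \1_(`]0, +oo[) t * t `^ (a - 1).

Lemma pospow_gt0E a t : 0 < t -> pospow a t = t `^ (a - 1).
Proof. by move=> t0; rewrite /pospow indicE mem_set ?mul1r//= in_itv/= t0. Qed.

Lemma pospow_le0 a t : t <= 0 -> pospow a t = 0.
Proof.
move=> t0; rewrite /pospow indicE memNset ?mul0r//= in_itv/= andbT.
by apply/negP; rewrite -leNgt.
Qed.

Lemma pospow_ge0 a t : 0 <= pospow a t.
Proof. by rewrite mulr_ge0// powR_ge0. Qed.

End pospow.

Ltac pos_prod := rewrite /= lee_fin; repeat first
  [exact: pospow_ge0 | exact: expR_ge0 | exact: powR_ge0 | apply: mulr_ge0].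

(** * The Beta convolution and the product of two Gamma integrals *)

Section gamma_beta.
Context {R : realType}.
Notation mu := (@lebesgue_measure R).
Implicit Types a b t u : R.

(** Lets the monomials from the moment and from the 0F1 series be absorbed into the parameters of a
    Dirichlet integrand. *)
Lemma pospow_nat a n t : 0 < a ->
  pospow (a + n%:R) t = pospow a t * t ^+ n.
Proof.
move=> a0; have [t0|t0] := leP t 0; first by rewrite !pospow_le0// mul0r.
rewrite !pospow_gt0E// -powR_mulrn ?ltW// -powRD.
  by rewrite addrAC.
by rewrite (gt_eqF t0) implybT.
Qed.

Lemma measurable_pospow a : measurable_fun setT (pospow a).
Proof. by apply: measurable_funM => //; exact: measurable_indic. Qed.

Lemma measurableT_comp_pospow a d (T : measurableType d) (g : T -> R) :
  measurable_fun setT g -> measurable_fun setT (fun x => pospow a (g x)).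
Proof. by move=> mg; apply: (measurableT_comp (measurable_pospow a) mg). Qed.

(* Extended-real versions, so that no integrability is needed beforehand. *)
Definition eBeta a b : \bar R :=
  (\int[mu]_s (pospow a s * pospow b (1 - s))%R%:E)%E.

Definition eGamma a : \bar R := (\int[mu]_t (pospow a t * expR (- t))%R%:E)%E.

(** For [u <= 0], [s] and [u - s] cannot both be positive and the integrand vanishes. For [0 < u],
    substituting [s = u * x] extracts [u^(a-1) * u^(b-1) * u] and leaves the Beta integral. *)
Lemma pospow_convolution a b u :
  (\int[mu]_s (pospow a s * pospow b (u - s))%R%:E
   = (pospow (a + b)%R u)%:E * eBeta a b)%E.
Proof.
have [u0|u0] := leP u 0.
  rewrite pospow_le0// mul0e integral0_eq// => s _.
  have [s0|s0] := leP s 0; first by rewrite pospow_le0// mul0r.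
  by rewrite [X in _ * X]pospow_le0 ?mulr0// subr_le0 (le_trans u0)// ltW.
pose f s := (pospow a s * pospow b (u - s))%:E.
apply: etrans (esym (@ge0_integral_affine R u 0 f u0 _ _)) _.
- apply/measurable_EFinP/measurable_funM; first exact: measurable_pospow.
  by apply: measurableT_comp_pospow; exact: measurable_funB.
- by move=> x; pos_prod.
have scale c x : pospow c (u * x) = u `^ (c - 1) * pospow c x.
  have [x0|x0] := leP x 0.
    by rewrite !pospow_le0 ?mulr0// pmulr_rle0.
  by rewrite !pospow_gt0E ?mulr_gt0// powRM// ltW.
under eq_integral => x _.
  rewrite /f addr0 -[X in X - _ * _]mulr1 -mulrBr !scale mulrACA EFinM.
  over.
rewrite ge0_integralZl//.
- rewrite muleA -EFinM; congr (_%:E * _)%E.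
  rewrite pospow_gt0E// -[X in X * _](powRr1 (ltW u0)) -!powRD ?(gt_eqF u0) ?implybT//.
  by congr (_ `^ _); ring.
- apply/measurable_EFinP/measurable_funM; first exact: measurable_pospow.
  by apply: measurableT_comp_pospow; exact: measurable_funB.
- by move=> x _; pos_prod.
- by pos_prod.
Qed.

Lemma eGamma_ge0 a : (0 <= eGamma a)%E.
Proof. by apply: integral_ge0 => t _; pos_prod. Qed.

Lemma eBeta_ge0 a b : (0 <= eBeta a b)%E.
Proof. by apply: integral_ge0 => t _; pos_prod. Qed.

Lemma measurable_expRN : measurable_fun setT (fun x : R => expR (- x)).
Proof. by apply: measurableT_comp => //; exact: measurable_funB. Qed.

Lemma measurable_Gamma_integrand a :
  measurable_fun setT (fun t : R => pospow a t * expR (- t)).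
Proof.
by apply: measurable_funM; [exact: measurable_pospow|exact: measurable_expRN].
Qed.

(** The product is a double integral; translating the inner variable merges the exponentials into
    [expR (- u)], and after Tonelli the integral over [t] is a convolution. *)
Lemma eGammaM a b : (eGamma a * eGamma b = eBeta a b * eGamma (a + b)%R)%E.
Proof.
transitivity (\int[mu]_t \int[mu]_u
    (pospow a t * pospow b (u - t) * expR (- u))%R%:E)%E.
  rewrite {1}/eGamma -ge0_integralZr//; last 3 first.
  - apply/measurable_EFinP; exact: measurable_Gamma_integrand.
  - by move=> t _; pos_prod.
  - exact: eGamma_ge0.
  apply: eq_integral => t _.
  rewrite -ge0_integralZl//; last 3 first.
  - apply/measurable_EFinP; exact: measurable_Gamma_integrand.
  - by move=> x _; pos_prod.
  - by pos_prod.
  (* The translation replaces [x] by [x - t], so the new variable stands for the sum of the two old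
     ones. *)
  pose f x := (pospow a t * expR (- t) * (pospow b x * expR (- x)))%:E.
  transitivity (\int[mu]_x f x)%E; first by apply: eq_integral => x _.
  apply: etrans (esym (@ge0_integral_affine R 1 (- t) f _ _ _)) _ => //.
  - apply/measurable_EFinP/measurable_funM => //.
    exact: measurable_Gamma_integrand.
  - by move=> x; pos_prod.
  rewrite mul1e; apply: eq_integral => x _; rewrite /f mul1r; congr EFin.
  have -> : - (x - t) = - x + t by ring.
  by rewrite expRD [expR (- t)]expRN; field; rewrite gt_eqF ?expR_gt0.
pose g (x : R * R) := (pospow a x.1 * pospow b (x.2 - x.1) * expR (- x.2))%:E.
apply: etrans (_ : _ = \int[mu]_u \int[mu]_t g (t, u))%E _.
  apply: (@fubini_tonelli _ _ (measurableTypeR R) (measurableTypeR R) R mu mu g).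
  - apply/measurable_EFinP/measurable_funM.
    apply: measurable_funM.
      exact: (measurableT_comp (measurable_pospow a) measurable_fst).
    apply: (measurableT_comp (measurable_pospow b)).
    exact: measurable_funB.
  exact: (measurableT_comp measurable_expRN measurable_snd).
  - by move=> x; rewrite /g; pos_prod.
rewrite muleC /eGamma -ge0_integralZr//; last 3 first.
- apply/measurable_EFinP; exact: measurable_Gamma_integrand.
- by move=> x _; pos_prod.
- exact: eBeta_ge0.
apply: eq_integral => u _.
rewrite /g /=; under eq_integral do rewrite EFinM.
rewrite ge0_integralZr//; last 2 first.
- apply/measurable_EFinP/measurable_funM; first exact: measurable_pospow.
  by apply: measurableT_comp_pospow; exact: measurable_funB.
- by move=> x _; pos_prod.
by rewrite pospow_convolution EFinM muleAC.
Qed.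

End gamma_beta.

(** * Functional equation, finiteness and positivity of Gamma *)

Section gamma.
Context {R : realType}.
Notation mu := (@lebesgue_measure R).
Implicit Types a b : R.

Lemma eGammaE a :
  (eGamma a = \int[mu]_(t in `]0%R, +oo[) (t `^ (a - 1) * expR (- t))%R%:E)%E.
Proof.
rewrite [RHS]integral_mkcond; apply: eq_integral => t _.
rewrite patchE; have [t0|t0] := ltP 0 t.
  by rewrite mem_set ?pospow_gt0E//= in_itv/= t0.
rewrite memNset ?pospow_le0 ?mul0r//= in_itv/= andbT.
by apply/negP; rewrite -leNgt.
Qed.

(** [Gamma] is a real-valued integral, hence the [fine] part of the extended one; it carries
    information only once [eGamma a] is known to be finite. *)
Lemma fine_eGamma a : fine (eGamma a) = Gamma a.
Proof. by rewrite eGammaE. Qed.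

(** Used at [a = 0] to compute [eGamma 1], and at [a = 1] to bound Gamma away from zero. *)
Lemma integral_expRN_itvcy a :
  (\int[mu]_(t in `[a, +oo[) (expR (- t))%:E = (expR (- a))%:E)%E.
Proof.
have cF : continuous (fun x : R => expR (- x)).
  by move=> x; apply: continuous_comp; [exact: opp_continuous|exact: continuous_expR].
rewrite (@ge0_continuous_FTC2y _ _ (fun x => - expR (- x)) a 0).
- by rewrite sub0e -EFinN opprK.
- by move=> x _; exact: expR_ge0.
- exact: continuous_subspaceT.
- by rewrite -oppr0; apply: cvgN; apply: cvgr_expR.
- by move=> x _; apply: ex_derive.
- by apply: cvg_at_right_filter; apply: cvgN; exact: cF.
- by move=> x _; rewrite derive1E derive_val mulrN1 opprK.
Qed.

Lemma eGamma1 : eGamma 1 = 1%E :> \bar R.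
Proof.
rewrite eGammaE integral_itv_obnd_cbnd; last first.
  apply: measurable_funTS; apply/measurable_EFinP/measurable_funM => //.
  exact: measurable_expRN.
have := integral_expRN_itvcy 0; rewrite oppr0 expR0 => <-.
by apply: eq_integral => t _; rewrite subrr powRr0 mul1r.
Qed.

(** The cut at [e] avoids the singularity of the integrand at the origin when [a < 1], so the
    fundamental theorem of calculus applies. *)
Lemma integral_powR_itvcc (a e : R) : 0 < a -> 0 < e < 1 ->
  (\int[mu]_(s in `[e, 1%R]) (s `^ (a - 1))%:E = ((1 - e `^ a) / a)%R%:E)%E.
Proof.
move=> a0 /andP[e0 e1].
have a00 : a != 0 by rewrite gt_eqF.
have cpow b : {in `[e, 1], continuous (fun x => x `^ b)}.
  move=> x; rewrite in_itv/= => /andP[ex x1].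
  apply: differentiable_continuous; apply/derivable1_diffP.
  by have [] := is_derive1_powR b (lt_le_trans e0 ex).
rewrite (@continuous_FTC2 _ _ (fun x => x `^ a / a))//.
- by rewrite powR1 -EFinB mulrBl.
- by apply: continuous_in_subspaceT => x; rewrite inE/=; exact: cpow.
- split.
  + move=> x; rewrite in_itv/= => /andP[ex _].
    apply: derivableM => //.
    by have [] := is_derive1_powR a (lt_trans e0 ex).
  + apply: cvg_at_right_filter; apply: cvgM; last exact: cvg_cst.
    by apply: cpow; rewrite in_itv/= lexx ltW.
  + apply: cvg_at_left_filter; apply: cvgM; last exact: cvg_cst.
    by apply: cpow; rewrite in_itv/= lexx ltW.
- move=> x; rewrite in_itv/= => /andP[ex _].
  have [d1 d2] := is_derive1_powR a (lt_trans e0 ex).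
  by rewrite derive1Mr// derive1E d2; field.
Qed.

(** Monotone limit of the truncated integrals. Combined with [eGammaM], this value yields the
    functional equation of Gamma without integration by parts. *)
Lemma eBeta_1 a : 0 < a -> eBeta a 1 = (a^-1)%:E.
Proof.
move=> a0.
transitivity (\int[mu]_(s in `]0%R, 1%R]) (s `^ (a - 1))%:E)%E.
  rewrite -integral_itv_bndo_bndc; last first.
    by apply: measurable_funTS; apply/measurable_EFinP.
  rewrite [RHS]integral_mkcond; apply: eq_integral => s _.
  rewrite patchE; have [s0|s0] := ltP 0 s; last first.
    rewrite [in LHS]pospow_le0 ?mul0r// memNset//= in_itv/=.
    by apply/negP; rewrite negb_and -leNgt s0.
  have [s1|s1] := ltP s 1.
    rewrite !pospow_gt0E ?subr_gt0// mem_set/= ?in_itv/= ?s0 ?s1//.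
    by rewrite subrr powRr0 mulr1.
  rewrite (pospow_le0 1) ?subr_le0// mulr0 memNset//= in_itv/=.
  by apply/negP; rewrite negb_and -!leNgt s1 orbT.
(* Starting at [n.+2] keeps the left endpoint strictly below 1, as [integral_powR_itvcc] demands. *)
pose F n := `[(n.+2%:R^-1 : R), 1%R]%classic.
have F0 n : 0 < (n.+2%:R^-1 : R) < 1.
  by rewrite invr_gt0 ltr0n/= invf_lt1 ?ltr1n ?ltr0n.
have -> : `]0%R, 1%R]%classic = \bigcup_n F n.
  apply/seteqP; split => x /=.
    rewrite in_itv/= => /andP[x0 x1]; exists (Num.truncn x^-1) => //=.
    rewrite /F/= in_itv/= x1 andbT -[leRHS]invrK lef_pV2 ?posrE ?invr_gt0 ?ltr0n//.
    by rewrite (le_trans (ltW (truncnS_gt _)))// ler_nat.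
  move=> [n _]; rewrite /F /= !in_itv/= => /andP[nx ->].
  by rewrite andbT (lt_le_trans _ nx)//; case/andP: (F0 n).
have F_cvg : (\int[mu]_(s in F n) (s `^ (a - 1))%:E @[n --> \oo] -->
    \int[mu]_(s in \bigcup_n F n) (s `^ (a - 1))%:E)%E.
  apply: ge0_nondecreasing_set_cvg_integral.
  - move=> m n mn; apply/subsetPset => x; rewrite /F/= !in_itv/= => /andP[mx ->].
    by rewrite andbT (le_trans _ mx)// lef_pV2 ?posrE ?ltr0n// ler_nat !ltnS.
  - by move=> n; exact: measurable_itv.
  - by move=> n; apply: measurable_funTS; apply/measurable_EFinP.
  - by move=> n x _; rewrite lee_fin powR_ge0.
rewrite -(cvg_lim _ F_cvg)//; apply/cvg_lim => //.
under eq_fun do rewrite integral_powR_itvcc//.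
apply/cvg_EFin; first exact: nearW.
suff lim : (n.+2%:R^-1 : R) `^ a @[n --> \oo] --> (0 : R).
  rewrite -[X in _ --> X](_ : (1 - 0) / a = a^-1); last by rewrite subr0 mul1r.
  have lim' : (1 - (n.+2%:R^-1 : R) `^ a) / a @[n --> \oo] --> (1 - 0) / a.
    by apply: cvgM; [apply: cvgB => //; exact: cvg_cst|exact: cvg_cst].
  exact: lim'.
have /cvg_at_rightP := powR_cvg0 a0; apply; split.
  by move=> n; rewrite invr_gt0 ltr0n.
have := @cvg_harmonic R; rewrite -(cvg_shiftS (@harmonic R)); exact.
Qed.

Lemma eGammaS a : 0 < a -> eGamma (a + 1) = (a%:E * eGamma a)%E.
Proof.
move=> a0; have := eGammaM a 1.
rewrite eGamma1 mule1 eBeta_1// => ->.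
by rewrite muleA -EFinM divff ?gt_eqF// mul1e.
Qed.

Lemma eGamma_nat n : eGamma n.+1%:R = n`!%:R%:E :> \bar R.
Proof.
elim: n => [|n ih]; first exact: eGamma1.
by rewrite -addn1 natrD eGammaS// ih factS natrM EFinM.
Qed.

(** For [1 <= b], with [n] the integer part of [b], the bound [t^(b-1) <= 1 + t^n] dominates
    [eGamma b] by [1 + n!]. A general [a] follows from [a + 1] by the functional equation. *)
Lemma eGamma_fin_num a : 0 < a -> eGamma a \is a fin_num.
Proof.
move=> a0.
suff fin b : 1 <= b -> (eGamma b < +oo)%E.
  have /fin : 1 <= a + 1 by rewrite lerDr ltW.
  rewrite eGammaS// ge0_fin_numE ?eGamma_ge0//.
  case: (eGamma a) (eGamma_ge0 a) => [r _ _|_|//]; first exact: ltry.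
  by rewrite gt0_muley.
move=> b1; pose n := Num.truncn b.
have bn : b <= n.+1%:R by rewrite ltW// truncnS_gt.
apply: (@le_lt_trans _ _ (eGamma 1 + eGamma n.+1%:R)%E); last first.
  by rewrite eGamma1 eGamma_nat -EFinD ltry.
rewrite -ge0_integralD//=.
- apply: ge0_le_integral => //=.
  + by move=> x _; pos_prod.
  + by apply/measurable_EFinP; exact: measurable_Gamma_integrand.
  + apply/measurable_EFinP.
    by apply: measurable_funD; exact: measurable_Gamma_integrand.
  + move=> x _; rewrite -EFinD lee_fin -mulrDl ler_wpM2r ?expR_ge0//.
    have [x0|x0] := leP x 0; first by rewrite !pospow_le0 ?addr0.
    rewrite !pospow_gt0E// subrr powRr0.
    (* On []0, 1]] the constant 1 dominates, beyond 1 the power [x^n] does, since [b <= n + 1]. *)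
    have [x1|x1] := leP x 1.
      rewrite -[leLHS]addr0 lerD ?powR_ge0//.
      by rewrite -[leRHS](powRr0 x) ger_powR ?x0//; lra.
    rewrite -[leLHS]add0r lerD//.
    by rewrite ler_powR ?lerD2r// ltW.
- by move=> x _; pos_prod.
- by apply/measurable_EFinP; exact: measurable_Gamma_integrand.
- by move=> x _; pos_prod.
- by apply/measurable_EFinP; exact: measurable_Gamma_integrand.
Qed.

Lemma eGamma_EFin a : 0 < a -> eGamma a = (Gamma a)%:E.
Proof. by move=> a0; rewrite -fine_eGamma fineK// eGamma_fin_num. Qed.

Lemma GammaS a : 0 < a -> Gamma (a + 1) = a * Gamma a.
Proof.
move=> a0; apply: EFin_inj.
by rewrite EFinM -!eGamma_EFin ?eGammaS// addr_gt0.
Qed.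

(** For [1 <= b] the integrand is at least [expR (- t)] on [[1, +oo[], whence the lower bound
    [expR (-1)]; the functional equation covers smaller arguments. *)
Lemma Gamma_gt0 a : 0 < a -> 0 < Gamma a.
Proof.
move=> a0; suff pos b : 1 <= b -> 0 < Gamma b.
  have /pos : 1 <= a + 1 by rewrite lerDr ltW.
  by rewrite GammaS// pmulr_rgt0.
move=> b1; have b0 : 0 < b by rewrite (lt_le_trans _ b1).
suff : ((expR (-1))%:E <= eGamma b)%E.
  by rewrite eGamma_EFin// lee_fin; apply: lt_le_trans; exact: expR_gt0.
rewrite -integral_expRN_itvcy eGammaE.
apply: (@le_trans _ _
  (\int[mu]_(t in `[1%R, +oo[) (t `^ (b - 1) * expR (- t))%R%:E)%E).
  apply: ge0_le_integral => //=.
  + by apply: measurable_funTS; apply/measurable_EFinP; exact: measurable_expRN.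
  + apply: measurable_funTS; apply/measurable_EFinP/measurable_funM => //.
    exact: measurable_expRN.
  + move=> x; rewrite in_itv/= andbT => x1.
    rewrite lee_fin ler_peMl ?expR_ge0//.
    by rewrite -[leLHS](powRr0 x) ler_powR// subr_ge0.
apply: ge0_subset_integral => //=.
- apply: measurable_funTS; apply/measurable_EFinP/measurable_funM => //.
  exact: measurable_expRN.
- by move=> x _; pos_prod.
- by move=> x /=; rewrite !in_itv/= !andbT; apply: lt_le_trans.
Qed.

Lemma Gamma_neq0 a : 0 < a -> Gamma a != 0.
Proof. by move=> a0; rewrite gt_eqF// Gamma_gt0. Qed.

(** An infinite Beta integral would make the right side of [eGammaM] infinite, as Gamma is positive,
    while the left side is finite. *)
Lemma eBetaE a b : 0 < a -> 0 < b ->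
  eBeta a b = (Gamma a * Gamma b / Gamma (a + b))%:E.
Proof.
move=> a0 b0; have ab0 : 0 < a + b by rewrite addr_gt0.
have := eGammaM a b; rewrite !eGamma_EFin// -EFinM.
case: (eBeta a b) (eBeta_ge0 a b) => [r _|_|//].
  by rewrite -EFinM => -[->]; rewrite mulfK ?Gamma_neq0.
by rewrite gt0_mulye ?lte_fin ?Gamma_gt0.
Qed.

End gamma.

(** * Rising factorials and the Chu-Vandermonde identity *)

Section rising.
Context {R : comPzRingType}.
Implicit Type a : R.

(** Polynomial counterpart of [pochhammer], so that Chu-Vandermonde becomes pure ring algebra;
    [pochhammerE] links the two. *)
Definition rising a n := \prod_(0 <= k < n) (a + k%:R).

Lemma rising0 a : rising a 0 = 1.
Proof. exact: big_geq. Qed.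

Lemma risingSl a n : rising a n.+1 = a * rising (a + 1) n.
Proof.
rewrite /rising big_nat_recl// mulr0n addr0; congr (_ * _).
by apply: eq_bigr => k _; rewrite -nat1r addrA.
Qed.

(* Chu-Vandermonde *)
Lemma rising_addn a i r :
  rising (a + i%:R) r = \sum_(0 <= j < r.+1)
    'C(r, j)%:R * (i ^_ j)%:R * rising (a + j%:R) (r - j).
Proof.
elim: r a => [|r ih] a.
  by rewrite big_nat1 bin0 ffactn0 !mul1r !rising0.
rewrite risingSl addrAC ih.
rewrite [RHS]big_nat_recl// bin0 ffactn0 !mul1r mulr0n addr0 subn0.
(* Pascal's rule splits the sum in two; the half with ['C(r, j.+1)], together with the leading term,
   reassembles into a sum over ['C(r, j)]. *)
under [in RHS]eq_bigr => j _ do rewrite binS natrD !mulrDl subSS.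
rewrite big_split/= addrA.
have -> : rising a r.+1 + \sum_(0 <= j < r.+1) 'C(r, j.+1)%:R *
    (i ^_ j.+1)%:R * rising (a + j.+1%:R) (r - j) =
  \sum_(0 <= j < r.+1) 'C(r, j)%:R * (i ^_ j)%:R *
    rising (a + j%:R) (r.+1 - j).
  rewrite big_nat_recr//= [RHS]big_nat_recl//= bin_small// !mul0r addr0.
  by rewrite bin0 ffactn0 !mul1r mulr0n addr0 subn0; congr (_ + _).
rewrite -big_split/= big_distrr/=; apply: eq_big_nat => j /andP[_ jr].
rewrite subSn// risingSl -natr1 [a + (_ + 1)]addrA [a + 1 + _]addrAC.
(* Termwise the claim is [a + i = (a + j) + (i - j)]. When [i < j] the natural subtraction
   truncates, but then the falling factorials are zero. *)
have [ij|ji] := ltnP i j.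
  by rewrite !ffact_small ?leqW// !(mulr0,mul0r,addr0).
by rewrite ffactnSr natrM natrB//; ring.
Qed.

End rising.

(** * Pochhammer symbols as quotients of Gamma values *)

Section pochhammer.
Context {R : realType}.
Implicit Types a b x y : R.

Lemma pochhammer0 a : 0 < a -> pochhammer a 0 = 1.
Proof. by move=> a0; rewrite /pochhammer mulr0n addr0 divff ?Gamma_neq0. Qed.

Lemma pochhammer_gt0 a n : 0 < a -> 0 < pochhammer a n.
Proof. by move=> a0; rewrite divr_gt0 ?Gamma_gt0// ltr_wpDr. Qed.

Lemma pochhammerD a m n : 0 < a ->
  pochhammer a (m + n) = pochhammer a m * pochhammer (a + m%:R) n.
Proof.
move=> a0; rewrite /pochhammer natrD addrA.
have := Gamma_neq0 _ a0; have : Gamma (a + m%:R) != 0 by rewrite Gamma_neq0 ?ltr_wpDr.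
by move: (Gamma _) (Gamma _) (Gamma _) => x y z x0 y0; field; rewrite x0 y0.
Qed.

Lemma pochhammer1 a : 0 < a -> pochhammer a 1 = a.
Proof. by move=> a0; rewrite /pochhammer GammaS// mulfK ?Gamma_neq0. Qed.

Lemma pochhammerSl a n : 0 < a ->
  pochhammer a n.+1 = a * pochhammer (a + 1) n.
Proof. by move=> a0; rewrite -add1n pochhammerD// pochhammer1. Qed.

Lemma Gamma_nat a n : 0 < a -> Gamma (a + n%:R) = pochhammer a n * Gamma a.
Proof. by move=> a0; rewrite /pochhammer mulfVK ?Gamma_neq0. Qed.

Lemma pochhammerE a n : 0 < a -> pochhammer a n = rising a n.
Proof.
elim: n a => [|n ih] a a0; first by rewrite pochhammer0 // rising0.
by rewrite pochhammerSl // risingSl ih // addr_gt0.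
Qed.

Lemma pochhammer_addn a i r : 0 < a ->
  pochhammer (a + i%:R) r = \sum_(0 <= j < r.+1)
    'C(r, j)%:R * (i ^_ j)%:R * pochhammer (a + j%:R) (r - j).
Proof.
move=> a0; have ai0 k : 0 < a + k%:R by rewrite ltr_wpDr.
rewrite pochhammerE // rising_addn; apply: eq_bigr => j _.
by rewrite pochhammerE.
Qed.

End pochhammer.

(** * The Dirichlet integral on the simplex *)

Section dirichlet.
Context {R : realType}.
Notation mu := (@lebesgue_measure R).
Implicit Types a b u : R.

Lemma measurable_Dirichlet_integrand b1 b2 b3 :
  measurable_fun setT (fun x : measurableTypeR R * measurableTypeR R =>
    pospow b1 x.1 * pospow b2 x.2 * pospow b3 (1 - x.1 - x.2)).
Proof.
apply: measurable_funM.
  apply: measurable_funM.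
    exact: (measurableT_comp (measurable_pospow b1) measurable_fst).
  exact: (measurableT_comp (measurable_pospow b2) measurable_snd).
apply: (measurableT_comp (measurable_pospow b3)).
by apply: measurable_funB => //; apply: measurable_funB.
Qed.

(** By Tonelli, the integral over the second coordinate is the convolution at [1 - x.1], with factor
    [B(b2, b3)]; the first coordinate then contributes [B(b1, b2 + b3)]. *)
Lemma Dirichlet_integral b1 b2 b3 : 0 < b1 -> 0 < b2 -> 0 < b3 ->
  (\int[mu \x mu]_x
     (pospow b1 x.1 * pospow b2 x.2 * pospow b3 (1 - x.1 - x.2))%R%:E =
   (Gamma b1 * Gamma b2 * Gamma b3 / Gamma (b1 + b2 + b3)%R)%R%:E)%E.
Proof.
move=> b10 b20 b30.
rewrite fubini_tonelli1//=; last 2 first.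
- by apply/measurable_EFinP; exact: measurable_Dirichlet_integrand.
- by move=> x; pos_prod.
transitivity (\int[mu]_x
    ((pospow b1 x * pospow (b2 + b3) (1 - x))%:E * eBeta b2 b3))%E.
  apply: eq_integral => x _; rewrite /fubini_F/=.
  pose f y := (pospow b2 y * pospow b3 (1 - x - y))%:E.
  transitivity (\int[mu]_y ((pospow b1 x)%:E * f y))%E.
    by apply: eq_integral => y _; rewrite /f -EFinM -[in LHS]mulrA.
  rewrite (@ge0_integralZl _ _ _ mu _ measurableT f); last 3 first.
  - apply/measurable_EFinP/measurable_funM; first exact: measurable_pospow.
    by apply: measurableT_comp_pospow; exact: measurable_funB.
  - by move=> y _; pos_prod.
  - by pos_prod.
  by rewrite pospow_convolution EFinM muleA.
rewrite ge0_integralZr//; last 3 first.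
- apply/measurable_EFinP/measurable_funM; first exact: measurable_pospow.
  by apply: measurableT_comp_pospow; exact: measurable_funB.
- by move=> y _; pos_prod.
- exact: eBeta_ge0.
rewrite -/(eBeta b1 (b2 + b3)) !eBetaE ?addr_gt0// -EFinM addrA; congr EFin.
have := Gamma_neq0 _ (addr_gt0 b20 b30).
have := Gamma_neq0 _ (addr_gt0 (addr_gt0 b10 b20) b30).
move: (Gamma (b1 + b2 + b3)) (Gamma (b2 + b3)) (Gamma b1) (Gamma b2) (Gamma b3).
by move=> g123 g23 g1 g2 g3 g1230 g230; field; rewrite g1230.
Qed.

End dirichlet.

(** * Rearrangement of nonnegative series *)

Section series.
Context {R : realType}.
Implicit Types x y : R.
Local Open Scope ereal_scope.

Lemma nneseries_ord_fin n (f : nat -> \bar R) : (forall i, 0 <= f i) ->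
  \sum_(i <oo) (if (i < n)%N then f i else 0) = \sum_(0 <= i < n) f i.
Proof.
move=> f0; rewrite (nneseries_split 0 n)//; last by move=> k _; case: ifP.
rewrite add0n [X in _ + X]eseries0 ?adde0; last first.
  by move=> i ni _; rewrite ltnNge ni.
by apply: eq_big_nat => i /andP[_ ->].
Qed.

(** Zero padding turns a shifted range into the full one, so that series with different starting
    points can be interchanged. *)
Lemma nneseries_shift n (f : nat -> \bar R) : (forall i, 0 <= f i) ->
  \sum_(i <oo) (if (n <= i)%N then f (i - n)%N else 0) = \sum_(i <oo) f i.
Proof.
move=> f0; rewrite (nneseries_split 0 n)//; last by move=> k _; case: ifP.
rewrite big_nat_cond big1 ?add0e; last first.
  by move=> i /andP[/andP[_ ilt] _]; rewrite leqNgt ilt.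
rewrite -nneseries_addn; last by move=> i; case: ifP.
by apply: eq_eseriesr => i _; rewrite leq_addl addnK.
Qed.

(** Cauchy rearrangement: index the inner series by [n = i + j], padded with zeros for [n < i], then
    interchange the two series. *)
Lemma nneseries_diagonal (f : nat -> nat -> \bar R) :
  (forall i j, 0 <= f i j) ->
  \sum_(i <oo) \sum_(j <oo) f i j =
  \sum_(n <oo) \sum_(0 <= i < n.+1) f i (n - i)%N.
Proof.
move=> f0.
transitivity (\sum_(i <oo) \sum_(n <oo)
    (if (i <= n)%N then f i (n - i)%N else 0)).
  by apply: eq_eseriesr => i _; rewrite (nneseries_shift i (f i)).
rewrite nneseries_interchange; last by move=> i j; case: ifP.
by apply: eq_eseriesr => n _; rewrite -nneseries_ord_fin.
Qed.

(** The binomial theorem divided by [n!], as [exp_coeff x n] is [x^n / n!]. *)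
Lemma exp_coeffD x y n :
  (exp_coeff (x + y) n = \sum_(0 <= i < n.+1) exp_coeff x i * exp_coeff y (n - i)%N)%R.
Proof.
rewrite /exp_coeff /= [(x + y)%R]addrC exprDn.
rewrite -(big_mkord xpredT (fun i => (y ^+ (n - i) * x ^+ i) *+ 'C(n, i))%R).
rewrite mulr_suml; apply: eq_big_nat => i /andP[_]; rewrite ltnS => ilen.
rewrite -(bin_fact ilen) !natrM -mulr_natr.
have ifact k : k`!%:R != 0%R :> R by rewrite pnatr_eq0 -lt0n fact_gt0.
have Cn0 : 'C(n, i)%:R != 0%R :> R by rewrite pnatr_eq0 -lt0n bin_gt0.
by field; rewrite !ifact Cn0.
Qed.

(** As [psi] depends only on [i + j], summing along diagonals merges two exponential variables into
    their sum. *)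
Lemma nneseries_exp_coeffD x y (psi : nat -> \bar R) :
  (0 <= x)%R -> (0 <= y)%R -> (forall n, 0 <= psi n) ->
  \sum_(i <oo) (exp_coeff x i)%:E * \sum_(j <oo) (exp_coeff y j)%:E * psi (i + j)%N =
  \sum_(n <oo) (exp_coeff (x + y) n)%:E * psi n.
Proof.
move=> x0 y0 psi0.
transitivity (\sum_(i <oo) \sum_(j <oo)
    (exp_coeff x i * exp_coeff y j)%:E * psi (i + j)%N).
  apply: eq_eseriesr => i _; rewrite -nneseriesZl; last first.
    by move=> j _; rewrite mule_ge0 ?lee_fin ?exp_coeff_ge0.
  by apply: eq_eseriesr => j _; rewrite EFinM muleA.
rewrite nneseries_diagonal; last first.
  move=> i j; apply: mule_ge0 => //.
  by rewrite lee_fin; apply: mulr_ge0; exact: exp_coeff_ge0.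
apply: eq_eseriesr => n _; rewrite exp_coeffD -sumEFin ge0_sume_distrl; last first.
  by move=> i _; rewrite lee_fin mulr_ge0 ?exp_coeff_ge0.
by apply: eq_big_nat => i /andP[_]; rewrite ltnS => ilen; rewrite subnKC.
Qed.

(** The falling factorial kills the terms with [i < j] and otherwise reduces [1 / i!] to
    [1 / (i - j)!]; the remaining series is shifted by [j]. *)
Lemma nneseries_ffact j x (phi : nat -> \bar R) :
  (0 <= x)%R -> (forall n, 0 <= phi n) ->
  \sum_(i <oo) ((i ^_ j)%:R * exp_coeff x i)%:E * phi i =
  (x ^+ j)%:E * \sum_(i <oo) (exp_coeff x i)%:E * phi (i + j)%N.
Proof.
move=> x0 phi0; rewrite -nneseriesZl; last first.
  by move=> i _; rewrite mule_ge0 ?lee_fin ?exp_coeff_ge0.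
rewrite -[RHS](nneseries_shift j); last first.
  by move=> i; rewrite !mule_ge0 ?lee_fin ?exp_coeff_ge0 ?exprn_ge0.
apply: eq_eseriesr => i _; case: ifPn => [ji|]; last first.
  by rewrite -ltnNge => ij; rewrite ffact_small// mul0r mul0e.
rewrite subnK// muleA -EFinM; congr (_%:E * _).
rewrite /exp_coeff /= [RHS]mulrA -exprD subnKC// -(ffact_fact ji) natrM mulrCA.
congr (_ * _)%R; rewrite invfM mulrA divff ?mul1r//.
by rewrite pnatr_eq0 -lt0n ffact_gt0.
Qed.

(** Links extended-real sums to the real limit defining [hyp0F1]. The limit is meaningful because a
    multiple of the exponential series dominates. *)
Lemma nneseries_hyp0F1 (b x : R) : (0 < b)%R -> (0 <= x)%R ->
  \sum_(i <oo) ((pochhammer b i)^-1 * exp_coeff x i)%R%:E = (hyp0F1 b x)%:E.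
Proof.
move=> b0 x0; rewrite /hyp0F1.
pose u (i : nat) := ((pochhammer b i)^-1 * exp_coeff x i)%R.
have u0 i : (0 <= u i)%R.
  apply: mulr_ge0; last by rewrite exp_coeff_ge0.
  by rewrite invr_ge0 ltW // pochhammer_gt0.
(* The symbol is 1 at [i = 0]; otherwise it is [b] times factors that are all at least 1. *)
have poch_ge i : (Num.min 1 b <= pochhammer b i)%R.
  case: i => [|i]; first by rewrite pochhammer0// ge_min lexx.
  have poch1 k c : (1 <= c -> 1 <= pochhammer c k)%R.
    elim: k c => [|k ih] c c1.
      by rewrite pochhammer0// (lt_le_trans _ c1).
    have c0 : (0 < c)%R by rewrite (lt_le_trans _ c1).
    rewrite pochhammerSl// -[leLHS]mulr1 ler_pM// ih//.
    by rewrite lerDr ltW.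
  rewrite pochhammerSl// ge_min; apply/orP; right.
  apply: ler_peMr; first exact: ltW.
  by apply: poch1; rewrite lerDr ltW.
have cu : cvgn (series u).
  apply: (@series_le_cvg _ u (fun i => (Num.min 1 b)^-1 * exp_coeff x i)%R).
  - exact: u0.
  - move=> i; rewrite mulr_ge0 ?exp_coeff_ge0// invr_ge0 le_min ler01 ltW//.
  - move=> i; rewrite ler_wpM2r ?exp_coeff_ge0//.
    by rewrite lef_pV2 ?posrE ?pochhammer_gt0// lt_min ltr01 b0.
  - apply: is_cvg_seriesZ; exact: is_cvg_series_exp_coeff.
rewrite -EFin_lim//; apply: congr_lim; apply/funext => n /=.
by rewrite sumEFin.
Qed.

End series.

(** * Triple series whose weight depends on the total index *)

Section triple_series.
Context {R : realType}.
Implicit Types x y c : R.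
Local Open Scope ereal_scope.

(** The falling factorials are absorbed first, in [j] and then in [i], each shift moving into the
    argument of [psi]. Two merges of exponential variables then leave a single series in
    [x1 + x2 + x3]. *)
Lemma nneseries_trinomial x1 x2 x3 j1 j2 (psi : nat -> \bar R) :
  (0 <= x1)%R -> (0 <= x2)%R -> (0 <= x3)%R -> (forall n, 0 <= psi n) ->
  \sum_(i <oo) ((i ^_ j1)%:R * exp_coeff x1 i)%:E *
    \sum_(j <oo) ((j ^_ j2)%:R * exp_coeff x2 j)%:E *
      \sum_(k <oo) (exp_coeff x3 k)%:E * psi (i + j + k)%N =
  (x1 ^+ j1 * x2 ^+ j2)%:E *
    \sum_(n <oo) (exp_coeff (x1 + x2 + x3) n)%:E * psi (n + (j1 + j2))%N.
Proof.
move=> x10 x20 x30 psi0.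
pose inner n := \sum_(k <oo) (exp_coeff x3 k)%:E * psi (n + k)%N.
have inner0 n : 0 <= inner n.
  by apply: nneseries_ge0 => k _ _; rewrite mule_ge0 ?lee_fin ?exp_coeff_ge0.
pose mid n := \sum_(j <oo) (exp_coeff x2 j)%:E * inner (n + j)%N.
have mid0 n : 0 <= mid n.
  by apply: nneseries_ge0 => k _ _; rewrite mule_ge0 ?lee_fin ?exp_coeff_ge0.
transitivity (\sum_(i <oo) ((i ^_ j1)%:R * exp_coeff x1 i)%:E *
    ((x2 ^+ j2)%:E * mid (i + j2)%N)).
  apply: eq_eseriesr => i _; congr (_ * _).
  rewrite (nneseries_ffact j2 x2 (fun j => inner (i + j)%N))//.
  by congr (_ * _); apply: eq_eseriesr => j _; rewrite addnA addnAC.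
rewrite (nneseries_ffact j1 x1 (fun i => (x2 ^+ j2)%:E * mid (i + j2)%N))//; last first.
  by move=> n; rewrite mule_ge0// lee_fin exprn_ge0.
rewrite EFinM -muleA; congr (_ * _).
transitivity (\sum_(i <oo) (x2 ^+ j2)%:E * ((exp_coeff x1 i)%:E *
    \sum_(j <oo) (exp_coeff x2 j)%:E * inner (i + j + (j1 + j2))%N)).
  apply: eq_eseriesr => i _; rewrite muleCA; congr (_ * (_ * _)).
  by apply: eq_eseriesr => j _; congr (_ * inner _); lia.
rewrite nneseriesZl; last first.
  move=> i _; rewrite mule_ge0 ?lee_fin ?exp_coeff_ge0//.
  by apply: nneseries_ge0 => k _ _; rewrite mule_ge0 ?lee_fin ?exp_coeff_ge0.
congr (_ * _).
rewrite (nneseries_exp_coeffD x1 x2 (fun n => inner (n + (j1 + j2))%N))//.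
rewrite -(nneseries_exp_coeffD (x1 + x2) x3
  (fun n => psi (n + (j1 + j2))%N)) ?addr_ge0//.
apply: eq_eseriesr => i _; congr (_ * _); apply: eq_eseriesr => k _.
by rewrite addnAC.
Qed.

Lemma nneseries3_sum_nat n (f : nat -> nat -> nat -> nat -> \bar R) :
  (forall s i j k, 0 <= f s i j k) ->
  \sum_(i <oo) \sum_(j <oo) \sum_(k <oo) \sum_(0 <= s < n) f s i j k =
  \sum_(0 <= s < n) \sum_(i <oo) \sum_(j <oo) \sum_(k <oo) f s i j k.
Proof.
move=> f0; rewrite -nneseries_sum_nat; last first.
  by move=> s i; apply: nneseries_ge0 => j _ _; exact: nneseries_ge0.
apply: eq_eseriesr => i _; rewrite -nneseries_sum_nat; last first.
  by move=> s j; exact: nneseries_ge0.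
by apply: eq_eseriesr => j _; rewrite -nneseries_sum_nat.
Qed.

(** Brings a flat triple series to the nested shape on which [nneseries_trinomial] acts. *)
Lemma nneseries3_nest c (A B C : nat -> R) (psi : nat -> R) : (0 <= c)%R ->
  (forall i, 0 <= A i)%R -> (forall i, 0 <= B i)%R -> (forall i, 0 <= C i)%R ->
  (forall i, 0 <= psi i)%R ->
  \sum_(i <oo) \sum_(j <oo) \sum_(k <oo)
    (c * (A i * B j * C k) * psi (i + j + k)%N)%:E =
  c%:E * \sum_(i <oo) (A i)%:E * \sum_(j <oo) (B j)%:E *
    \sum_(k <oo) (C k)%:E * (psi (i + j + k)%N)%:E.
Proof.
move=> c0 A0 B0 C0 psi0.
have in0 i j : 0 <= \sum_(k <oo) (C k)%:E * (psi (i + j + k)%N)%:E.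
  by apply: nneseries_ge0 => k _ _; rewrite mule_ge0 ?lee_fin.
have mid0 i : 0 <= \sum_(j <oo) (B j)%:E *
    \sum_(k <oo) (C k)%:E * (psi (i + j + k)%N)%:E.
  by apply: nneseries_ge0 => k _ _; rewrite mule_ge0 ?lee_fin.
rewrite -nneseriesZl; last by move=> i _; rewrite mule_ge0 ?lee_fin.
apply: eq_eseriesr => i _; rewrite muleA -EFinM -nneseriesZl; last first.
  by move=> j _; rewrite mule_ge0 ?lee_fin.
apply: eq_eseriesr => j _; rewrite muleA -EFinM -nneseriesZl; last first.
  by move=> k _; rewrite mule_ge0 ?lee_fin.
by apply: eq_eseriesr => k _; rewrite -!EFinM !mulrA.
Qed.

Lemma nneseries3M c (A B C : nat -> R) (s t u : R) : (0 <= c)%R ->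
  (forall i, 0 <= A i)%R -> (forall i, 0 <= B i)%R -> (forall i, 0 <= C i)%R ->
  \sum_(i <oo) (A i)%:E = s%:E -> \sum_(i <oo) (B i)%:E = t%:E ->
  \sum_(i <oo) (C i)%:E = u%:E ->
  \sum_(i <oo) \sum_(j <oo) \sum_(k <oo) (c * (A i * B j * C k))%:E =
  (c * (s * t * u))%:E.
Proof.
move=> c0 A0 B0 C0 As Bt Cu.
transitivity (\sum_(i <oo) \sum_(j <oo) \sum_(k <oo)
    (c * (A i * B j * C k) * cst 1%R (i + j + k)%N)%:E).
  by do 3 (apply: eq_eseriesr => ? _); rewrite mulr1.
rewrite nneseries3_nest//.
have t0 : (0 <= t)%R.
  by rewrite -lee_fin -Bt; apply: nneseries_ge0 => k _ _; rewrite lee_fin.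
have u0 : (0 <= u)%R.
  by rewrite -lee_fin -Cu; apply: nneseries_ge0 => k _ _; rewrite lee_fin.
have CE i j : \sum_(k <oo) (C k)%:E * (cst 1%R (i + j + k)%N)%:E = u%:E.
  by rewrite -Cu; apply: eq_eseriesr => k _; rewrite mule1.
have BE i : \sum_(j <oo) (B j)%:E *
    \sum_(k <oo) (C k)%:E * (cst 1%R (i + j + k)%N)%:E = (u * t)%:E.
  rewrite EFinM -Bt -nneseriesZl; last by move=> j _; rewrite lee_fin.
  by apply: eq_eseriesr => j _; rewrite CE muleC.
transitivity (c%:E * \sum_(i <oo) (u * t)%:E * (A i)%:E).
  by congr (_ * _); apply: eq_eseriesr => i _; rewrite BE muleC.
rewrite nneseriesZl; last by move=> j _; rewrite lee_fin.
by rewrite As -!EFinM; congr EFin; ring.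
Qed.

End triple_series.

(** * Resummation of the moment series *)

Section moment_series.
Context {R : realType}.
Implicit Types a x c : R.

(** The left side is what termwise Dirichlet integration produces; [c] stands for the inverse of the
    normalising 0F1. *)
Lemma moment_series a1 a2 a3 x1 x2 x3 c r1 r2 :
  0 < a1 -> 0 < a2 -> 0 < a3 -> 0 <= x1 -> 0 <= x2 -> 0 <= x3 -> 0 <= c ->
  let a := a1 + a2 + a3 in
  let r := (r1 + r2)%N in
  (\sum_(i <oo) \sum_(j <oo) \sum_(k <oo)
    (c * (pochhammer (a1 + i%:R) r1 * pochhammer (a2 + j%:R) r2) *
     (exp_coeff x1 i * exp_coeff x2 j * exp_coeff x3 k) /
     pochhammer a (i + j + k + r)%N)%R%:E)%E =
  (pochhammer a1 r1 * pochhammer a2 r2 / pochhammer a r *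
    \sum_(0 <= j1 < r1.+1) \sum_(0 <= j2 < r2.+1)
      ('C(r1, j1)%:R * 'C(r2, j2)%:R * x1 ^+ j1 * x2 ^+ j2 /
       (pochhammer a1 j1 * pochhammer a2 j2 *
        pochhammer (a + r%:R) (j1 + j2)) *
       (hyp0F1 (a + r%:R + (j1 + j2)%:R) (x1 + x2 + x3) * c)))%:E.
Proof.
move=> a10 a20 a30 x10 x20 x30 c0 a r.
have a0 : 0 < a by rewrite !addr_gt0.
(* Abstracting the special functions keeps unification from unfolding them
   down to Lebesgue integrals. *)
clearbody a r.
have := @pochhammerD R; have := @pochhammer_gt0 R.
have := @pochhammer_addn R; have := @nneseries_hyp0F1 R.
move: (@pochhammer R) (@hyp0F1 R) => p hyp hE pV pp pD.
have an0 (b : R) n : 0 < b -> 0 < b + n%:R by move=> b0; rewrite ltr_wpDr.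
pose psi n := (p a (n + r)%N)^-1.
have psi0 n : 0 <= psi n by rewrite invr_ge0 ltW // pp.
(* The part of the two Chu-Vandermonde expansions that is independent of [i], [j] and [k]. *)
pose W s t := c * ('C(r1, s)%:R * p (a1 + s%:R) (r1 - s)%N) *
   ('C(r2, t)%:R * p (a2 + t%:R) (r2 - t)%N).
have W0 s t : 0 <= W s t.
  apply: mulr_ge0; [apply: mulr_ge0 => //|]; apply: mulr_ge0 => //;
    by rewrite ltW // pp // an0.
transitivity (\sum_(i <oo) \sum_(j <oo) \sum_(k <oo)
    \sum_(0 <= s < r1.+1) \sum_(0 <= t < r2.+1)
    (W s t * (((i ^_ s)%:R * exp_coeff x1 i) * ((j ^_ t)%:R * exp_coeff x2 j) *
      exp_coeff x3 k) * psi (i + j + k)%N)%R%:E)%E.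
  apply: eq_eseriesr => i _; apply: eq_eseriesr => j _; apply: eq_eseriesr => k _.
  under [RHS]eq_bigr do rewrite sumEFin.
  rewrite sumEFin; congr EFin.
  rewrite (pV a1) // (pV a2) // big_distrlr /=.
  rewrite -/(psi _) mulr_sumr !mulr_suml; apply: eq_bigr => s _.
  rewrite mulr_sumr !mulr_suml; apply: eq_bigr => t _.
  rewrite /W.
  move: (psi _) (p _ _) (p _ _) (exp_coeff _ _) (exp_coeff _ _)
    (exp_coeff _ _) => p1 p2 p3 e1 e2 e3.
  by ring.
have term0 s t i j k : (0 <= (W s t * (((i ^_ s)%:R * exp_coeff x1 i) *
    ((j ^_ t)%:R * exp_coeff x2 j) * exp_coeff x3 k) * psi (i + j + k)%N)%R%:E)%E.
  rewrite lee_fin; apply: mulr_ge0 => //; apply: mulr_ge0 => //.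
  by repeat first [exact: exp_coeff_ge0 | exact: ler0n | apply: mulr_ge0].
rewrite nneseries3_sum_nat; last first.
  by move=> s i j k; apply: sume_ge0 => t _.
rewrite mulr_sumr -sumEFin; apply: eq_big_nat => s /andP[_]; rewrite ltnS => sr1.
rewrite nneseries3_sum_nat //.
rewrite mulr_sumr -sumEFin; apply: eq_big_nat => t /andP[_]; rewrite ltnS => tr2.
rewrite (nneseries3_nest (W s t) (fun i => (i ^_ s)%:R * exp_coeff x1 i)
  (fun j => (j ^_ t)%:R * exp_coeff x2 j) (exp_coeff x3) psi) //; last 3 first.
- by move=> i; apply: mulr_ge0 => //; exact: exp_coeff_ge0.
- by move=> i; apply: mulr_ge0 => //; exact: exp_coeff_ge0.
- by move=> i; exact: exp_coeff_ge0.
rewrite (nneseries_trinomial x1 x2 x3 s t (fun n => (psi n)%:E)) //.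
have ar0 : 0 < a + r%:R by rewrite an0.
(* The symbol of total length [r + (s + t) + n] is cut into three blocks; only the last depends on
   [n], and it supplies the coefficients of the shifted 0F1. *)
have psiE n : psi (n + (s + t))%N =
    (p a r * p (a + r%:R) (s + t)%N)^-1 *
    (p (a + r%:R + (s + t)%:R) n)^-1.
  have e : (n + (s + t) + r = r + (s + t) + n)%N.
    by rewrite addnC [(n + _)%N]addnC addnA.
  by rewrite /psi e pD // pD // invfM natrD addrA.
transitivity ((W s t)%:E * ((x1 ^+ s * x2 ^+ t)%:E *
    ((p a r * p (a + r%:R) (s + t)%N)^-1%:E *
     (hyp (a + r%:R + (s + t)%:R) (x1 + x2 + x3))%:E)))%E.
  congr (_ * (_ * _))%E; rewrite -hE ?an0 ?addr_ge0 //.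
  rewrite -nneseriesZl; last first.
    move=> n _; rewrite lee_fin; apply: mulr_ge0.
      by rewrite invr_ge0 ltW // pp // an0.
    by rewrite exp_coeff_ge0 ?addr_ge0.
  apply: eq_eseriesr => n _; rewrite psiE -!EFinM; congr EFin.
  by rewrite mulrC -mulrA.
rewrite -!EFinM; congr EFin.
(* The second factor already occurs in [W], so [p a1 s] is what ends up in the denominator of the
   formula. *)
have -> : p a1 r1 = p a1 s * p (a1 + s%:R) (r1 - s)%N.
  by rewrite -pD // subnKC.
have -> : p a2 r2 = p a2 t * p (a2 + t%:R) (r2 - t)%N.
  by rewrite -pD // subnKC.
rewrite /W.
have := pp a1 s a10; have := pp a2 t a20.
have := pp a r a0; have := pp _ (s + t) ar0.
move: (p a1 s) (p a2 t) (p a r)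
  (p (a + r%:R) (s + t)%N) (p (a1 + s%:R) (r1 - s)%N)
  (p (a2 + t%:R) (r2 - t)%N) (hyp _ _).
move=> p1 p2 p3 p4 p5 p6 h p40 p30 p20 p10.
by field; rewrite !gt_eqF.
Qed.

End moment_series.

(** * Integration against a measure with a density *)

Section density.
Context d (T : measurableType d) (R : realType).
Import HBNNSimple.
Variables (m nu : {measure set T -> \bar R}) (q : T -> R).
Hypotheses (mq : measurable_fun setT q) (q0 : forall x, 0 <= q x).
Hypothesis nuE : forall A, measurable A -> nu A = (\int[m]_(x in A) (q x)%:E)%E.
Local Open Scope ereal_scope.

(** The law is specified on sets only. The identity extends from indicators to simple functions by
    linearity and to [h] by monotone convergence on both sides. *)
Lemma ge0_integral_density (h : T -> \bar R) : measurable_fun setT h ->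
  (forall x, 0 <= h x) ->
  \int[nu]_x h x = \int[m]_x (h x * (q x)%:E).
Proof.
move=> mh h0.
pose h_ := nnsfun_approx measurableT mh.
transitivity (limn (fun n => \int[nu]_x (h_ n x)%:E)).
  rewrite -monotone_convergence//.
  - by apply: eq_integral => x _; apply/esym/cvg_lim => //; exact: cvg_nnsfun_approx.
  - by move=> n; apply/measurable_EFinP/measurable_funP.
  - by move=> n x _; rewrite lee_fin.
  - by move=> x _ i j ij; rewrite lee_fin; exact/lefP/nd_nnsfun_approx.
transitivity (limn (fun n => \int[m]_x ((h_ n x)%:E * (q x)%:E))); last first.
  rewrite -monotone_convergence//.
  - apply: eq_integral => x _; apply/cvg_lim => //.
    by apply: cvgeZr => //; exact: cvg_nnsfun_approx.
  - by move=> n; apply: emeasurable_funM; apply/measurable_EFinP.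
  - by move=> n x _; rewrite mule_ge0 ?lee_fin.
  - move=> x _ i j ij; rewrite lee_wpmul2r ?lee_fin//.
    exact/lefP/nd_nnsfun_approx.
congr (limn _); apply/funext => n.
rewrite integralT_nnsfun sintegralE.
pose f r x := r%:E * (\1_(h_ n @^-1` [set r]) x)%:E * (q x)%:E.
have f0 r x : 0 <= f r x.
  by apply: mule_ge0; [exact: nnfun_muleindic_ge0|rewrite lee_fin].
have mf r : measurable_fun setT (f r).
  apply: emeasurable_funM; last exact/measurable_EFinP.
  by apply/measurable_EFinP/measurable_funM.
transitivity (\int[m]_x (\sum_(r \in range (h_ n)) f r x)%R); last first.
  apply: eq_integral => x _; rewrite fimfunE -fsumEFin// ge0_mule_fsuml//.
  by move=> r; rewrite EFinM nnfun_muleindic_ge0.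
rewrite ge0_integral_fsum//; apply: eq_fsbigr => r rh.
have r0 : (0 <= r)%R by move: rh; rewrite inE => -[x _ <-].
rewrite /f; under [RHS]eq_integral do rewrite -muleA.
rewrite ge0_integralZl//.
- rewrite nuE//; congr (_ * _).
  rewrite integral_mkcond; apply: eq_integral => x _.
  by rewrite patchE indicE; case: ifPn => _; rewrite ?mul1e ?mul0e.
- by apply: emeasurable_funM; apply/measurable_EFinP.
- by move=> x _; rewrite mule_ge0 ?lee_fin.
Qed.

End density.

(** * Measurability of the simplex *)

Section simplex.
Context {R : realType}.
Notation mu := (@lebesgue_measure R).

Lemma simplex2E (x : R * R) :
  simplex2 R x <-> [/\ 0 < x.1, 0 < x.2 & 0 < 1 - x.1 - x.2].
Proof.
split=> [[/andP[? ?] /andP[? ?] ?]|[? ? ?]]; first by split => //; lra.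
by split; lra.
Qed.

(** The Dirichlet integrand with all parameters 1 is positive exactly on the simplex, which is thus
    the preimage of a half-line. *)
Lemma measurable_simplex2 :
  measurable (simplex2 R : set (measurableTypeR R * measurableTypeR R)).
Proof.
have := measurable_Dirichlet_integrand (1 : R) 1 1.
move=> /(_ measurableT _ (measurable_itv `]0, +oo[)); rewrite setTI => mA.
rewrite (_ : simplex2 R = (fun x => pospow 1 x.1 * pospow 1 x.2 *
  pospow 1 (1 - x.1 - x.2)) @^-1` `]0, +oo[) //; apply/seteqP; split => x.
  move=> /simplex2E[x1 x2 x3]; rewrite /= in_itv/= andbT.
  by rewrite !pospow_gt0E // !mulr_gt0 // powR_gt0.
rewrite /= in_itv/= andbT => gx; apply/simplex2E.
split; rewrite ltNge; apply/negP => x0; move: gx;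
  by rewrite (pospow_le0 _ _ x0) ?(mul0r,mulr0) ltxx.
Qed.

End simplex.

(** * Series expansion and moments of the density *)

Section pdf.
Context {R : realType}.
Notation mu := (@lebesgue_measure R).
Variables (a1 a2 a3 l1 l2 l3 : R).
Hypotheses (a10 : 0 < a1) (a20 : 0 < a2) (a30 : 0 < a3).
Hypotheses (l10 : 0 <= l1) (l20 : 0 <= l2) (l30 : 0 <= l3).

Lemma hyp0F1_ge0 (b x : R) : 0 < b -> 0 <= x -> 0 <= hyp0F1 b x.
Proof.
move=> b0 x0; rewrite -lee_fin -nneseries_hyp0F1 //.
apply: nneseries_ge0 => n _ _; rewrite lee_fin; apply: mulr_ge0.
  by rewrite invr_ge0 ltW // pochhammer_gt0.
exact: exp_coeff_ge0.
Qed.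

Let K := Gamma (a1 + a2 + a3) / (Gamma a1 * Gamma a2 * Gamma a3) /
  hyp0F1 (a1 + a2 + a3) ((l1 + l2 + l3) / 4).

(** Coefficient of [t^n] in [hyp0F1 b (l / 4 * t)]; the power of [t] is left out so that [pospow]
    can absorb it. *)
Let coef (b l : R) n := (pochhammer b n)^-1 * exp_coeff (l / 4) n.

Let coef_ge0 b l n : 0 < b -> 0 <= l -> 0 <= coef b l n.
Proof.
move=> b0 l0; apply: mulr_ge0; first by rewrite invr_ge0 ltW // pochhammer_gt0.
by rewrite exp_coeff_ge0 // divr_ge0.
Qed.

Let K_ge0 : 0 <= K.
Proof.
apply: divr_ge0; last by rewrite hyp0F1_ge0 ?addr_gt0 // divr_ge0 // !addr_ge0.
by rewrite ltW // divr_gt0 ?mulr_gt0 // Gamma_gt0 // !addr_gt0.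
Qed.

Let term r1 r2 i j k (x : R * R) : \bar R :=
  (K * (coef a1 l1 i * coef a2 l2 j * coef a3 l3 k) *
   (pospow (a1 + i%:R + r1%:R) x.1 * pospow (a2 + j%:R + r2%:R) x.2 *
    pospow (a3 + k%:R) (1 - x.1 - x.2)))%:E.

Let term_ge0 r1 r2 i j k x : (0 <= term r1 r2 i j k x)%E.
Proof.
rewrite lee_fin; apply: mulr_ge0.
  by apply: mulr_ge0 => //; repeat first [exact: coef_ge0 | apply: mulr_ge0].
by repeat first [exact: pospow_ge0 | apply: mulr_ge0].
Qed.

Let measurable_term r1 r2 i j k : measurable_fun
  (setT : set (measurableTypeR R * measurableTypeR R)) (term r1 r2 i j k).
Proof.
apply/measurable_EFinP/measurable_funM => //.
exact: measurable_Dirichlet_integrand.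
Qed.

(** On the simplex this multiplies out the three 0F1 series. Elsewhere some coordinate is
    nonpositive and its [pospow] annihilates every term, so the series encodes the restriction. *)
Lemma CNcDir2_pdf_series r1 r2 x :
  (((fun x => x.1 ^+ r1 * x.2 ^+ r2 * CNcDir2_pdf a1 a2 a3 l1 l2 l3 x)
     \_ (simplex2 R)) x)%:E =
  (\sum_(i <oo) \sum_(j <oo) \sum_(k <oo) term r1 r2 i j k x)%E.
Proof.
rewrite patchE; case: ifPn => [|/negP]; rewrite inE => /simplex2E.
  move=> [x1 x2 x3]; rewrite /CNcDir2_pdf.
  set x3' := 1 - x.1 - x.2 in x3 *.
  pose A (b l t : R) i := (pochhammer b i)^-1 * exp_coeff (l / 4 * t) i.
  have A0 b l t i : 0 < b -> 0 <= l -> 0 < t -> 0 <= A b l t i.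
    move=> b0 l0 t0; apply: mulr_ge0.
      by rewrite invr_ge0 ltW // pochhammer_gt0.
    by rewrite exp_coeff_ge0 // mulr_ge0 ?divr_ge0 // ltW.
  have AE b l t : 0 < b -> 0 <= l -> 0 < t ->
      (\sum_(i <oo) (A b l t i)%:E = (hyp0F1 b (l / 4 * t))%:E)%E.
    move=> b0 l0 t0; rewrite -nneseries_hyp0F1 //.
    by rewrite mulr_ge0 ?divr_ge0 // ltW.
  have AcE b l t i : A b l t i = coef b l i * t ^+ i.
    by rewrite /A /coef /exp_coeff /= exprMn mulrAC mulrA.
  pose c := K * (x.1 ^+ r1 * x.2 ^+ r2) *
    (pospow a1 x.1 * pospow a2 x.2 * pospow a3 x3').
  have c0 : 0 <= c.
    apply: mulr_ge0; last by repeat first [exact: pospow_ge0 | apply: mulr_ge0].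
    by apply: mulr_ge0 => //; rewrite mulr_ge0 ?exprn_ge0 // ltW.
  transitivity (\sum_(i <oo) \sum_(j <oo) \sum_(k <oo)
     (c * (A a1 l1 x.1 i * A a2 l2 x.2 j * A a3 l3 x3' k))%:E)%E.
    rewrite (nneseries3M c (A a1 l1 x.1) (A a2 l2 x.2) (A a3 l3 x3')
      _ _ _ c0 _ _ _ (AE _ _ _ a10 l10 x1) (AE _ _ _ a20 l20 x2)
      (AE _ _ _ a30 l30 x3)); last 3 first.
    - by move=> i; exact: A0.
    - by move=> i; exact: A0.
    - by move=> i; exact: A0.
    congr EFin; rewrite /c /K !pospow_gt0E //.
    move: (Gamma _) (Gamma _) (Gamma _) (Gamma _) (hyp0F1 _ _) (hyp0F1 _ _)
      (hyp0F1 _ _) (hyp0F1 _ _) (_ `^ _) (_ `^ _) (_ `^ _) (_ ^+ _) (_ ^+ _).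
    move=> g g1 g2 g3 h1 h2 h3 h p1 p2 p3 e1 e2.
    by move: (_^-1) (_^-1) => *; ring.
  apply: eq_eseriesr => i _; apply: eq_eseriesr => j _; apply: eq_eseriesr => k _.
  rewrite /term -/x3' !pospow_nat ?ltr_wpDr //; congr EFin.
  rewrite /c !AcE.
  move: (pospow _ _) (pospow _ _) (pospow _ _) K (coef _ _ _) (coef _ _ _) (coef _ _ _).
  by move=> *; ring.
move=> x_out; apply/esym/eseries0 => i _ _; apply: eseries0 => j _ _.
apply: eseries0 => k _ _; rewrite /term.
suff -> : forall b1 b2 b3, pospow b1 x.1 * pospow b2 x.2 *
    pospow b3 (1 - x.1 - x.2) = 0 by rewrite mulr0.
move=> b1 b2 b3.
have [x1|x1] := leP x.1 0; first by rewrite (pospow_le0 _ _ x1) !mul0r.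
have [x2|x2] := leP x.2 0; first by rewrite (pospow_le0 _ _ x2) mulr0 mul0r.
have [x3|x3] := leP (1 - x.1 - x.2) 0.
  by rewrite (pospow_le0 _ _ x3) mulr0.
by exfalso; apply: x_out.
Qed.

(** The case of zero exponents transfers sign and measurability from the terms to the density. *)
Let pdf_series0 x : ((CNcDir2_pdf a1 a2 a3 l1 l2 l3 \_ (simplex2 R)) x)%:E =
  (\sum_(i <oo) \sum_(j <oo) \sum_(k <oo) term 0 0 i j k x)%E.
Proof.
rewrite -CNcDir2_pdf_series; congr EFin.
by rewrite !patchE; case: ifP => // _; rewrite !expr0 !mul1r.
Qed.

Lemma CNcDir2_pdf_ge0 x : 0 <= (CNcDir2_pdf a1 a2 a3 l1 l2 l3 \_ (simplex2 R)) x.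
Proof.
rewrite -lee_fin pdf_series0; apply: nneseries_ge0 => i _ _.
by apply: nneseries_ge0 => j _ _; exact: nneseries_ge0.
Qed.

Lemma measurable_CNcDir2_pdf :
  measurable_fun (setT : set (measurableTypeR R * measurableTypeR R))
    (CNcDir2_pdf a1 a2 a3 l1 l2 l3 \_ (simplex2 R)).
Proof.
apply/measurable_EFinP.
apply: (eq_measurable_fun (fun x =>
  \sum_(i <oo) \sum_(j <oo) \sum_(k <oo) term 0 0 i j k x)%E).
  by move=> x _; rewrite /= pdf_series0.
apply: ge0_emeasurable_sum => [i x _ _|i _].
  by apply: nneseries_ge0 => j _ _; exact: nneseries_ge0.
apply: ge0_emeasurable_sum => [j x _ _|j _]; first exact: nneseries_ge0.
by apply: ge0_emeasurable_sum => [k x _ _|k _];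
  [exact: term_ge0|exact: measurable_term].
Qed.

Lemma integral_CNcDir2_moment r1 r2 :
  let a := a1 + a2 + a3 in
  let l := l1 + l2 + l3 in
  let r := (r1 + r2)%N in
  (\int[mu \x mu]_x (((fun x => x.1 ^+ r1 * x.2 ^+ r2 *
      CNcDir2_pdf a1 a2 a3 l1 l2 l3 x) \_ (simplex2 R)) x)%:E)%E =
  (pochhammer a1 r1 * pochhammer a2 r2 / pochhammer a r *
    \sum_(0 <= j1 < r1.+1) \sum_(0 <= j2 < r2.+1)
      ('C(r1, j1)%:R * 'C(r2, j2)%:R * (l1 / 4) ^+ j1 * (l2 / 4) ^+ j2 /
       (pochhammer a1 j1 * pochhammer a2 j2 *
        pochhammer (a + r%:R) (j1 + j2)) *
       (hyp0F1 (a + r%:R + (j1 + j2)%:R) (l / 4) / hyp0F1 a (l / 4))))%:E.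
Proof.
move=> a l r.
under eq_integral do rewrite CNcDir2_pdf_series.
have t0 i j x : (0 <= \sum_(k <oo) term r1 r2 i j k x)%E by exact: nneseries_ge0.
have t1 i x : (0 <= \sum_(j <oo) \sum_(k <oo) term r1 r2 i j k x)%E.
  exact: nneseries_ge0.
have mt0 i j : measurable_fun (setT : set (measurableTypeR R * measurableTypeR R))
    (fun x => \sum_(k <oo) term r1 r2 i j k x)%E.
  by apply: ge0_emeasurable_sum => [k x _ _|k _];
  [exact: term_ge0|exact: measurable_term].
have mt1 i : measurable_fun (setT : set (measurableTypeR R * measurableTypeR R))
    (fun x => \sum_(j <oo) \sum_(k <oo) term r1 r2 i j k x)%E.
  by apply: ge0_emeasurable_sum => [j x _ _|j _]; first exact: t0.
rewrite integral_nneseries //.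
have l_ge0 : 0 <= l / 4 by rewrite divr_ge0 // !addr_ge0.
have a_gt0 : 0 < a by rewrite !addr_gt0.
have lE : l / 4 = l1 / 4 + l2 / 4 + l3 / 4 by rewrite /l !mulrDl.
rewrite [in RHS]lE.
rewrite -(moment_series a1 a2 a3 (l1 / 4) (l2 / 4) (l3 / 4)) ?divr_ge0 //; last first.
  by rewrite invr_ge0 -lE hyp0F1_ge0.
apply: eq_eseriesr => i _; rewrite integral_nneseries //.
apply: eq_eseriesr => j _; rewrite integral_nneseries //.
apply: eq_eseriesr => k _.
have p1 : 0 < a1 + i%:R by rewrite ltr_wpDr.
have p2 : 0 < a2 + j%:R by rewrite ltr_wpDr.
have p3 : 0 < a3 + k%:R by rewrite ltr_wpDr.
have p1r : 0 < a1 + i%:R + r1%:R by rewrite ltr_wpDr.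
have p2r : 0 < a2 + j%:R + r2%:R by rewrite ltr_wpDr.
rewrite /term; under eq_integral do rewrite EFinM.
rewrite ge0_integralZl //; last 3 first.
- by apply/measurable_EFinP; exact: measurable_Dirichlet_integrand.
- by move=> x _; pos_prod.
- rewrite lee_fin; apply: mulr_ge0 => //.
  by repeat first [exact: coef_ge0 | apply: mulr_ge0].
rewrite Dirichlet_integral // -EFinM; congr EFin.
have -> : a1 + i%:R + r1%:R + (a2 + j%:R + r2%:R) + (a3 + k%:R) =
    a + (i + j + k + r)%:R by rewrite /a /r !natrD; ring.
(* Each shifted Gamma becomes Pochhammer symbols times an unshifted one: the latter cancel the
   constant in [K], and the symbols of lengths [i], [j], [k] cancel those in [coef]. *)
rewrite (Gamma_nat _ _ p1) (Gamma_nat _ _ p2) (Gamma_nat _ _ a10).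
rewrite (Gamma_nat _ _ a20) (Gamma_nat _ _ a30) (Gamma_nat _ _ a_gt0).
rewrite /K /coef -/a -/l -lE.
have := Gamma_neq0 _ a10; have := Gamma_neq0 _ a20; have := Gamma_neq0 _ a30.
have := Gamma_neq0 _ a_gt0.
have := pochhammer_gt0 _ i a10; have := pochhammer_gt0 _ j a20.
have := pochhammer_gt0 _ k a30; have := pochhammer_gt0 _ (i + j + k + r)%N a_gt0.
move: (Gamma a) (Gamma a1) (Gamma a2) (Gamma a3) (pochhammer a1 i)
  (pochhammer a2 j) (pochhammer a3 k) (pochhammer a (i + j + k + r))
  (pochhammer (a1 + i%:R) r1) (pochhammer (a2 + j%:R) r2) (hyp0F1 a (l / 4))^-1
  (exp_coeff (l1 / 4) i) (exp_coeff (l2 / 4) j) (exp_coeff (l3 / 4) k).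
move=> g g1 g2 g3 q1 q2 q3 q c1 c2 h e1 e2 e3 q0 q30 q20 q10 g0 g30 g20 g10.
by field; rewrite g0 g10 g20 g30 !gt_eqF.
Qed.

End pdf.

(** * Transfer from the joint law to the expectation *)

Theorem proposition3p15 (R : realType) (a1 a2 a3 l1 l2 l3 : R)
    (ha1 : 0 < a1) (ha2 : 0 < a2) (ha3 : 0 < a3)
    (hl1 : 0 <= l1) (hl2 : 0 <= l2) (hl3 : 0 <= l3)
    (d : measure_display) (T : measurableType d) (P : probability T R)
    (X1 X2 : {RV P >-> R})
    (hX : has_CNcDir2_law X1 X2 a1 a2 a3 l1 l2 l3)
    (r1 r2 : nat) (hr1 : (0 < r1)%N) (hr2 : (0 < r2)%N) :
  let a := a1 + a2 + a3 in
  let l := l1 + l2 + l3 in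
  let r := (r1 + r2)%N in
  'E_P[(fun w => X1 w ^+ r1 * X2 w ^+ r2)%R]%E =
  (pochhammer a1 r1 * pochhammer a2 r2 / pochhammer a r *
    \sum_(0 <= j1 < r1.+1) \sum_(0 <= j2 < r2.+1)
      ('C(r1, j1)%:R * 'C(r2, j2)%:R * (l1 / 4) ^+ j1 * (l2 / 4) ^+ j2 /
       (pochhammer a1 j1 * pochhammer a2 j2 *
        pochhammer (a + r%:R) (j1 + j2)) *
       (hyp0F1 (a + r%:R + (j1 + j2)%:R) (l / 4) / hyp0F1 a (l / 4))))%:E.
Proof.
move=> a l r.
pose phi w : measurableTypeR R * measurableTypeR R := (X1 w, X2 w).
have mphi : measurable_fun setT phi.
  apply: measurable_fun_pair.
    exact: (measurable_funPT X1).
  exact: (measurable_funPT X2).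
pose q : measurableTypeR R * measurableTypeR R -> R :=
  CNcDir2_pdf a1 a2 a3 l1 l2 l3 \_ (simplex2 R).
have q0 x : 0 <= q x by exact: CNcDir2_pdf_ge0.
pose nu := measure_function_pushforward__canonical__measure_function_Measure P mphi.
have nuE A : measurable A ->
    nu A = (\int[lebesgue_measure \x lebesgue_measure]_(x in A) (q x)%:E)%E.
  move=> mA; rewrite [LHS](hX A mA) /CNcDir2 integral_mkcondr.
  by apply: eq_integral => x _; rewrite restrict_EFin.
have mS := @measurable_simplex2 R.
(* The restricted density vanishes off the simplex, so the pair lies in it almost surely. *)
have PS : P (phi @^-1` (~` simplex2 R)) = 0%E.
  rewrite -[LHS]/(nu (~` simplex2 R)) nuE; last exact: measurableC.
  by apply: integral0_eq => x Sx; rewrite /q patchE memNset.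
(* Off the simplex, a null set for the law, the moment integrand may be
   negative; absolute values keep all integrals in the nonnegative setting. *)
pose H (x : measurableTypeR R * measurableTypeR R) :=
  (`|x.1| ^+ r1 * `|x.2| ^+ r2)%:E.
have H0 x : (0 <= H x)%E by rewrite lee_fin mulr_ge0 // exprn_ge0.
have mH : measurable_fun setT H.
  apply/measurable_EFinP/measurable_funM; apply: measurable_funX.
    exact: (measurableT_comp (@normr_measurable _ setT) measurable_fst).
  exact: (measurableT_comp (@normr_measurable _ setT) measurable_snd).
transitivity (\int[P]_w H (phi w))%E.
  rewrite unlock; apply: ae_eq_integral => //.
  - apply/measurable_EFinP; apply: measurable_funM; exact: measurable_funX.
  - exact: measurableT_comp.
  exists (phi @^-1` (~` simplex2 R)); split => //.
    by rewrite -[X in measurable X]setTI; apply: (mphi) => //; exact: measurableC.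
  move=> w /= Hw Sw; apply: Hw => _.
  by case/simplex2E: Sw => /= x1 x2 _; rewrite /H /phi /= !gtr0_norm.
transitivity (\int[nu]_x H x)%E.
  by rewrite (ge0_integral_pushforward mphi).
have mq : measurable_fun setT q by exact: measurable_CNcDir2_pdf.
rewrite (ge0_integral_density _ _ _ (lebesgue_measure \x lebesgue_measure)%E nu
  q mq q0 nuE H mH H0).
rewrite -integral_CNcDir2_moment //; apply: eq_integral => x _.
rewrite -EFinM; congr EFin; rewrite /q !patchE.
(* Off the simplex the zero density cancels [H]; on it both coordinates are positive and the
   absolute values disappear. *)
case: ifPn => [|_]; last by rewrite mulr0.
by rewrite inE => /simplex2E[x1 x2 _]; rewrite !gtr0_norm.
Qed.
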